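(* Let $G$ be a $k$-regular (finite simple) graph of order $n$ and let $\bar{G}$ be its complement. Then $$SO(K_n) = \left(\sqrt{SO(G)} + \sqrt{SO(\bar{G})}\right)^2,$$ where $K_n$ is the complete graph on $n$ vertices.
   Context: For a finite simple graph $G$, the Sombor index is $SO(G)=\sum_{uv\in E(G)}\sqrt{d_u^2+d_v^2}$, the sum being over (unordered) edges, where $d_x$ is the degree of the vertex $x$. The order of a graph is its number of vertices. *)

(* Defs.v *)
From HB Require Import structures.
From mathcomp Require Import all_boot all_order all_algebra.

Set Implicit Arguments.
Unset Strict Implicit.
Unset Printing Implicit Defensive.

Import Order.TTheory GRing.Theory Num.Theory.

Local Open Scope ring_scope.

Record sgraph (V : finType) := SGraph {
  adj :> rel V;
  adj_sym : symmetric adj;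
  adj_irr : irreflexive adj
}.

Definition deg (V : finType) (G : sgraph V) (x : V) : nat := #|[set y | G x y]|.

Definition regular (V : finType) (G : sgraph V) (k : nat) : Prop :=
  forall x : V, deg G x = k.

(* An edge is the unordered pair of its endpoints, i.e. a 2-element set. *)
Definition edges (V : finType) (G : sgraph V) : {set {set V}} :=
  [set [set p.1; p.2] | p : V * V & G p.1 p.2].

Definition compl_rel (V : finType) (G : sgraph V) : rel V :=
  fun x y => (x != y) && ~~ G x y.

Lemma compl_sym (V : finType) (G : sgraph V) : symmetric (compl_rel G).
Proof. by move=> x y; rewrite /compl_rel eq_sym adj_sym. Qed.

Lemma compl_irr (V : finType) (G : sgraph V) : irreflexive (compl_rel G).
Proof. by move=> x; rewrite /compl_rel eqxx. Qed.

Definition compl (V : finType) (G : sgraph V) : sgraph V :=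
  SGraph (compl_sym G) (compl_irr G).

Definition complete_rel (n : nat) : rel 'I_n := fun x y => x != y.

Lemma complete_sym (n : nat) : symmetric (@complete_rel n).
Proof. by move=> x y; rewrite /complete_rel eq_sym. Qed.

Lemma complete_irr (n : nat) : irreflexive (@complete_rel n).
Proof. by move=> x; rewrite /complete_rel eqxx. Qed.

Definition complete (n : nat) : sgraph 'I_n :=
  SGraph (@complete_sym n) (@complete_irr n).

(* For an edge e = [set u; v] we have u != v, so the inner sum is
   (deg G u)^2 + (deg G v)^2; each unordered edge is counted once. *)
Definition sombor (R : rcfType) (V : finType) (G : sgraph V) : R :=
  \sum_(e in edges G) Num.sqrt (\sum_(x in e) (deg G x)%:R ^+ 2).

(* Main.v *)
(** A [k]-regular graph on [n] vertices has [n k / 2] edges, each contributing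
    [k sqrt 2], so its Sombor index is [n sqrt 2 / 2] times [k ^ 2] and the
    square root of the index is linear in [k].  The degrees of [G] and of its
    complement add up to [n - 1], the degree of the complete graph. *)
Require Import Defs.
From HB Require Import structures.
From mathcomp Require Import all_boot all_order all_algebra.
From mathcomp Require Import ring.

Set Implicit Arguments.
Unset Strict Implicit.
Unset Printing Implicit Defensive.

Import Order.TTheory GRing.Theory Num.Theory.

Local Open Scope ring_scope.

Lemma edgesP (V : finType) (G : sgraph V) (e : {set V}) :
  reflect (exists x y, G x y /\ e = [set x; y]) (e \in edges G).
Proof.
apply: (iffP imsetP) => [[[x y]]|[x [y [Gxy ->]]]].
  by rewrite inE /= => Gxy ->; exists x, y.
by exists (x, y); rewrite ?inE.
Qed.

Lemma adj_neq (V : finType) (G : sgraph V) (x y : V) : G x y -> x != y.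
Proof. by apply: contraTneq => ->; rewrite adj_irr. Qed.

Lemma card_edge (V : finType) (G : sgraph V) (e : {set V}) :
  e \in edges G -> #|e| = 2%N.
Proof. by case/edgesP => x [y [/adj_neq xy ->]]; rewrite cards2 xy. Qed.

(** The map sending [y] to [[set x; y]] is a bijection from the neighbours of [x] onto the edges
    through [x]. *)
Lemma card_incident_edges (V : finType) (G : sgraph V) (x : V) :
  #|[set e in edges G | x \in e]| = deg G x.
Proof.
have -> : [set e in edges G | x \in e] =
          [set [set x; y] | y in [set y | G x y]].
  apply/setP => e; rewrite inE; apply/andP/imsetP => [[]|[y]].
    case/edgesP => a [b [Gab ->]]; rewrite !inE => /orP[]/eqP->.
      by exists b; rewrite ?inE.
    by exists a; rewrite ?inE 1?adj_sym // setUC.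
  rewrite inE => Gxy ->; split; last by rewrite !inE eqxx.
  by apply/edgesP; exists x, y.
(* Injectivity: if [[set x; y] = [set x; z]], then [y] lies in the right-hand set and differs from
   [x], so it is [z]. *)
rewrite card_in_imset // => y z; rewrite !inE => /adj_neq xy _ /setP/(_ y).
by rewrite !inE eqxx orbT eq_sym (negPf xy) => /esym/eqP.
Qed.

(** Double counting of the pairs formed by an edge and one of its endpoints. *)
Lemma handshake (V : finType) (G : sgraph V) :
  (\sum_x deg G x = #|edges G| * 2)%N.
Proof.
transitivity (\sum_(e in edges G) \sum_(x in e) 1)%N; last first.
  rewrite -sum_nat_const; apply: eq_bigr => e /card_edge.
  by rewrite sum1_card.
rewrite (exchange_big_dep predT) //=; apply: eq_bigr => x _.
by rewrite -card_incident_edges -sum1_card; apply: eq_bigl => e; rewrite inE.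
Qed.

Lemma sombor_regular (R : rcfType) (V : finType) (G : sgraph V) (k : nat) :
  regular G k ->
  sombor R G = #|V|%:R * Num.sqrt 2 / 2 * k%:R ^+ 2.
Proof.
move=> hk.
have handshakeR : #|V|%:R * k%:R = #|edges G|%:R * 2 :> R.
  rewrite -!natrM -handshake; congr (_%:R).
  by rewrite (eq_bigr (fun=> k)) ?sum_nat_const // => x _; apply: hk.
have -> : sombor R G = #|edges G|%:R * (Num.sqrt 2 * k%:R).
  rewrite /sombor mulr_natl -sumr_const; apply: eq_bigr => e /card_edge e2.
  rewrite (eq_bigr (fun=> k%:R ^+ 2)) => [|x _]; last by rewrite hk.
  (* An edge has two endpoints, so the radicand is [2 * k ^ 2]. *)
  by rewrite sumr_const e2 -[_ ^+ 2 *+ 2]mulr_natl sqrtrM // sqrtr_sqr normr_nat.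
have -> : #|edges G|%:R = #|V|%:R * k%:R / 2 :> R.
  by rewrite handshakeR mulfK // pnatr_eq0.
by ring.
Qed.

(** The vertices other than [x] split into the neighbours of [x] in [G] and those in the
    complement. *)
Lemma deg_compl (V : finType) (G : sgraph V) (x : V) :
  (deg G x + deg (compl G) x = #|V|.-1)%N.
Proof.
rewrite -(cardsC1 x) /deg -(cardsID [set y | G x y] [set~ x]).
congr (_ + _)%N; apply: eq_card => y; rewrite !inE /=.
  by case Gxy: (G x y); rewrite ?andbF // eq_sym (adj_neq Gxy).
by rewrite /compl_rel andbC eq_sym.
Qed.

Lemma regular_compl (V : finType) (G : sgraph V) (k : nat) :
  regular G k -> regular (compl G) (#|V|.-1 - k).
Proof. by move=> hk x; rewrite -(deg_compl G x) hk addKn. Qed.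

Lemma regular_complete (n : nat) : regular (complete n) n.-1.
Proof.
move=> x; rewrite -[in RHS](card_ord n) -(cardsC1 x).
by apply: eq_card => y; rewrite !inE eq_sym.
Qed.

Theorem theorem6p1 (R : rcfType) (V : finType) (n k : nat) (G : sgraph V)
    (hn : #|V| = n) (hk : regular G k) :
  sombor R (complete n) =
    (Num.sqrt (sombor R G) + Num.sqrt (sombor R (compl G))) ^+ 2.
Proof.
rewrite (sombor_regular R (@regular_complete n)) (sombor_regular R hk).
rewrite (sombor_regular R (regular_compl hk)) card_ord hn.
set c := _ * _ / _.
(* All three indices share the factor [c]; its sign lets each square root split as [Num.sqrt c]
   times a degree. *)
have c_ge0 : 0 <= c by rewrite !mulr_ge0 ?invr_ge0 ?sqrtr_ge0 ?ler0n.
rewrite !(sqrtrM _ c_ge0) !sqrtr_sqr !normr_nat -mulrDr exprMn sqr_sqrtr // -natrD.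
(* Without vertices [k] is arbitrary and may exceed [n.-1], but then [c] is zero. Otherwise any
   vertex gives [k <= n.-1], so the truncated subtraction is exact. *)
have [n0|] := posnP n; first by rewrite /c n0 !mul0r.
rewrite -hn => /card_gt0P[x _].
by rewrite subnKC // -(deg_compl G x) hk leq_addr.
Qed.
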